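(* Let $P\subseteq\{0,1,\dots,2n\}$ be a pattern of an $(n+1)\times(n+1)$ partial Hankel matrix. If $P$ is positive semidefinite completable, then $P$ is positive definite completable.
   Context: An $(n+1)\times(n+1)$ partial Hankel matrix is $H_n=[s_{i+j}]_{i,j=0}^{n}$ where some of the real entries $s_0,s_1,\dots,s_{2n}$ are specified and the others are unspecified (so the specified entries fill whole skew-diagonals). Its pattern is $P=\{k\in\{0,1,\dots,2n\} : s_k\text{ is specified}\}$. It is partial positive definite (resp. partial positive semidefinite) if each of its fully specified principal submatrices is positive definite (resp. positive semidefinite). A positive definite (resp. positive semidefinite) completion is a choice of real values for the unspecified $s_k$ resulting in a positive definite (resp. positive semidefinite) Hankel matrix. A pattern $P$ of an $(n+1)\times(n+1)$ partial Hankel matrix is positive definite (resp. positive semidefinite) completable if every partial positive definite (resp. partial positive semidefinite) Hankel matrix with pattern $P$ has a positive definite (resp. positive semidefinite) completion. *)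

(* Defs.v *)
From mathcomp Require Import all_boot all_order all_algebra.
From mathcomp Require Import reals.

Set Implicit Arguments.
Unset Strict Implicit.
Unset Printing Implicit Defensive.

Import Order.TTheory GRing.Theory Num.Theory.
Local Open Scope ring_scope.

Definition posdef (R : realType) (m : nat) (A : 'M[R]_m) : Prop :=
  A^T = A /\ forall x : 'cV[R]_m, x != 0 -> 0 < (x^T *m A *m x) 0 0.

Definition possemidef (R : realType) (m : nat) (A : 'M[R]_m) : Prop :=
  A^T = A /\ forall x : 'cV[R]_m, 0 <= (x^T *m A *m x) 0 0.

(* [inord] never truncates here: i + j <= 2 * n for i, j : 'I_n.+1. *)
Definition hankel (T : Type) (n : nat) (s : 'I_(2 * n).+1 -> T) :
    'M[T]_n.+1 :=
  \matrix_(i < n.+1, j < n.+1) s (inord (i + j)).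

(* A partial Hankel matrix is [hankel s] with s valued in [option R], where
   [None] marks an unspecified entry. *)
Definition pattern (R : realType) (n : nat) (s : 'I_(2 * n).+1 -> option R) :
    {set 'I_(2 * n).+1} :=
  [set k | isSome (s k)].

Definition principal_submx (T : Type) (m : nat) (a : {set 'I_m})
    (A : 'M[T]_m) : 'M[T]_#|a| :=
  mxsub (@enum_val _ (mem a)) (@enum_val _ (mem a)) A.

(* A matrix over [option R] is fully specified, with real entries B, when it is
   [map_mx Some B]. *)
Definition partial_posdef (R : realType) (m : nat) (A : 'M[option R]_m) :
    Prop :=
  forall (a : {set 'I_m}) (B : 'M[R]_#|a|),
    principal_submx a A = map_mx Some B -> posdef B.

Definition partial_possemidef (R : realType) (m : nat)
    (A : 'M[option R]_m) : Prop :=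
  forall (a : {set 'I_m}) (B : 'M[R]_#|a|),
    principal_submx a A = map_mx Some B -> possemidef B.

Definition completes (R : realType) (n : nat) (t : 'I_(2 * n).+1 -> R)
    (s : 'I_(2 * n).+1 -> option R) : Prop :=
  forall k v, s k = Some v -> t k = v.

Definition posdef_completable (R : realType) (n : nat)
    (P : {set 'I_(2 * n).+1}) : Prop :=
  forall s : 'I_(2 * n).+1 -> option R,
    pattern s = P -> partial_posdef (hankel s) ->
    exists t : 'I_(2 * n).+1 -> R, completes t s /\ posdef (hankel t).

Definition possemidef_completable (R : realType) (n : nat)
    (P : {set 'I_(2 * n).+1}) : Prop :=
  forall s : 'I_(2 * n).+1 -> option R,
    pattern s = P -> partial_possemidef (hankel s) ->
    exists t : 'I_(2 * n).+1 -> R, completes t s /\ possemidef (hankel t).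

(* Main.v *)
Require Import Defs.
From mathcomp Require Import all_boot all_order all_algebra.
From mathcomp Require Import reals.
From mathcomp Require Import ring lra.

(** Let [m] be the moments of a measure with n + 1 atoms, so that [hankel m] is
    positive definite. If [s] is partial positive definite then [s - e m] is
    still partial positive semidefinite for small [e > 0], because each of the
    finitely many specified principal blocks dominates a multiple of the
    corresponding block of [hankel m]. Adding [e m] to a positive semidefinite
    completion of [s - e m] gives a positive definite completion of [s]. *)

Set Implicit Arguments.
Unset Strict Implicit.
Unset Printing Implicit Defensive.

Import Order.TTheory GRing.Theory Num.Theory.
Local Open Scope ring_scope.

Lemma mulmx_bilinE (R : comNzRingType) (m : nat) (A : 'M[R]_m) (x y : 'cV[R]_m) :
  (x^T *m A *m y) 0 0 = \sum_i \sum_j A i j * (x i 0 * y j 0).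
Proof.
rewrite mxE exchange_big /=; apply: eq_bigr => j _.
rewrite mxE mulr_suml; apply: eq_bigr => i _.
by rewrite mxE; ring.
Qed.

Lemma bilin_sym (R : comNzRingType) (m : nat) (A : 'M[R]_m) (x y : 'cV[R]_m) :
  A^T = A -> (x^T *m A *m y) 0 0 = (y^T *m A *m x) 0 0.
Proof.
move=> sA; rewrite -[in RHS]sA -[y in RHS]trmxK -(trmxK x) -!trmx_mul.
by rewrite !trmxK mulmxA [RHS]mxE.
Qed.

Lemma posdef_possemidef (R : realType) (m : nat) (B : 'M[R]_m) :
  posdef B -> possemidef B.
Proof.
move=> [sB pB]; split=> // x; have [->|x0] := eqVneq x 0.
  by rewrite mulmx0 mxE.
exact/ltW/pB.
Qed.

Lemma posdef_row_free (R : realType) (m : nat) (B : 'M[R]_m) :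
  posdef B -> row_free B.
Proof.
move=> [_ pB]; apply: inj_row_free => v vB0; apply/eqP/negPn/negP => v0.
have /pB : v^T != 0 by apply: contra v0 => /eqP h; rewrite -(trmxK v) h trmx0.
by rewrite trmxK vB0 mul0mx mxE ltxx.
Qed.

Lemma posdef_Cauchy_Schwarz (R : realType) (m : nat) (B : 'M[R]_m)
    (u x : 'cV[R]_m) :
  posdef B ->
  (u^T *m B *m x) 0 0 ^+ 2 <= (u^T *m B *m u) 0 0 * (x^T *m B *m x) 0 0.
Proof.
move=> pdB; have [sB pB] := pdB; have [->|u0] := eqVneq u 0.
  by rewrite trmx0 !mul0mx !mxE mul0r expr0n.
have q0 := pB u u0.
set q : R := (u^T *m B *m u) 0 0 in q0 *.
set b : R := (u^T *m B *m x) 0 0; set p : R := (x^T *m B *m x) 0 0.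
(* The vector [q *: x - b *: u] is [q] times the component of [x] that is [B]-orthogonal to [u];
   scaling by [q] avoids a division. *)
have := (posdef_possemidef pdB).2 (q *: x - b *: u).
have -> : ((q *: x - b *: u)^T *m B *m (q *: x - b *: u)) 0 0
          = q * (q * p - b ^+ 2).
  rewrite [(_ - _)^T]linearB /= ![(_ *: _)^T]linearZ /= mulmxBl mulmxBr !mulmxBl.
  rewrite -!scalemxAr -!scalemxAl.
  have entryB (C D : 'M[R]_1) : (C - D) 0 0 = C 0 0 - D 0 0 by rewrite !mxE.
  have entryZ c (C : 'M[R]_1) : (c *: C) 0 0 = c * C 0 0 by rewrite mxE.
  by rewrite !(entryB, entryZ) (bilin_sym x u sB) -/q -/b -/p; ring.
by rewrite pmulr_rge0 // subr_ge0.
Qed.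

(** Since [B] is invertible, the [i]-th coordinate is the functional [x |-> u^T B x] with
    [u^T = e_i^T B^-1]. Cauchy-Schwarz then gives the bound with [c = u^T B u]. *)
Lemma posdef_coord_bound (R : realType) (m : nat) (B : 'M[R]_m) (i : 'I_m) :
  posdef B ->
  exists2 c : R, 0 <= c & forall x : 'cV[R]_m, x i 0 ^+ 2 <= c * (x^T *m B *m x) 0 0.
Proof.
move=> pB; pose u : 'cV[R]_m := (delta_mx 0 i *m pinvmx B)^T.
exists ((u^T *m B *m u) 0 0); first exact: (posdef_possemidef pB).2.
move=> x; have := posdef_Cauchy_Schwarz u x pB.
suff -> : (u^T *m B *m x) 0 0 = x i 0 by [].
rewrite /u trmxK mulmxKpV; last first.
  by apply: submx_full; rewrite /row_full -/(row_free B) posdef_row_free.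
by rewrite -rowE mxE.
Qed.

(** No compactness of the sphere is used: the form of [M] is expanded entrywise,
    [|x_i x_j| <= x_i^2 + x_j^2], and each square is controlled by the coordinate bound. *)
Lemma posdef_dominates (R : realType) (m : nat) (B M : 'M[R]_m) :
  posdef B ->
  exists2 C : R, 0 <= C &
    forall x : 'cV[R]_m, (x^T *m M *m x) 0 0 <= C * (x^T *m B *m x) 0 0.
Proof.
move=> pB.
have [c c0 cB] := fin_all_exists2 (fun i => posdef_coord_bound i pB).
exists (\sum_i \sum_j `|M i j| * (c i + c j)).
  by do 2![apply: sumr_ge0 => ? _]; rewrite mulr_ge0 // addr_ge0.
move=> x; rewrite mulmx_bilinE mulr_suml; apply: ler_sum => i _.
rewrite mulr_suml; apply: ler_sum => j _.
rewrite -mulrA (le_trans (ler_norm _)) // normrM ler_wpM2l // mulrDl.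
apply: le_trans (lerD (cB i x) (cB j x)).
rewrite ler_norml; apply/andP; split; nra.
Qed.

Lemma hankel_sym (R : realType) (n : nat) (s : 'I_(2 * n).+1 -> R) :
  (hankel s)^T = hankel s.
Proof. by apply/matrixP => i j; rewrite !mxE addnC. Qed.

(** Moments of the counting measure on the nodes 0, ..., n. The node 0 contributes 1 to the moment
    of order 0, as [0 ^+ 0 = 1]. *)
Definition node_moments (R : realType) (n : nat) (k : 'I_(2 * n).+1) : R :=
  \sum_(l < n.+1) l%:R ^+ k.

(** The Hankel form of a measure at [x] is the integral of the square of the polynomial with
    coefficients [x]. *)
Lemma hankel_node_moments_form (R : realType) (n : nat) (x : 'cV[R]_n.+1) :
  (x^T *m hankel (@node_moments R n) *m x) 0 0
  = \sum_(l < n.+1) (\poly_(i < n.+1) x (inord i) 0).[l%:R] ^+ 2.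
Proof.
rewrite mulmx_bilinE.
under eq_bigr => i _ do under eq_bigr => j _ do rewrite mxE mulr_suml.
under eq_bigr => i _ do rewrite exchange_big /=.
rewrite exchange_big /=; apply: eq_bigr => l _.
rewrite horner_poly expr2 mulr_suml; apply: eq_bigr => i _.
rewrite mulr_sumr; apply: eq_bigr => j _.
have ij : (i + j < (2 * n).+1)%N by rewrite ltnS mul2n -addnn leq_add // -ltnS.
by rewrite (inordK ij) exprD !inord_val; ring.
Qed.

Lemma hankel_node_moments_posdef (R : realType) (n : nat) :
  posdef (hankel (@node_moments R n)).
Proof.
split=> [|x x0]; first exact: hankel_sym.
rewrite hankel_node_moments_form lt0r sumr_ge0 => [|l _]; last exact: sqr_ge0.
rewrite andbT; apply: contra x0; rewrite psumr_eq0 => [|l _]; last exact: sqr_ge0.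
move=> /allP px0; set p := (\poly_(i < _) _) in px0.
(* A polynomial of size at most n + 1 that vanishes at n + 1 distinct nodes is zero. *)
have p0 : p = 0.
  apply: (@roots_geq_poly_eq0 _ _ [seq l%:R | l : 'I_n.+1]).
  - apply/allP => _ /mapP[l _ ->].
    by have := px0 l (mem_index_enum l); rewrite /= sqrf_eq0.
  - rewrite map_inj_uniq ?enum_uniq // => k l /eqP.
    by rewrite eqr_nat => /eqP /val_inj.
  - by rewrite size_map size_enum_ord; exact: size_poly.
apply/eqP/colP => i; rewrite mxE.
by have /(congr1 (fun q : {poly R} => q`_i)) := p0; rewrite coef_poly ltn_ord coef0 inord_val.
Qed.

Lemma partial_posdef_dominates (R : realType) (m : nat) (A : 'M[option R]_m)
    (M : 'M[R]_m) :
  partial_posdef A ->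
  exists2 C : R, 0 <= C &
    forall (a : {set 'I_m}) (B : 'M[R]_#|a|),
      principal_submx a A = map_mx Some B -> forall x : 'cV[R]_#|a|,
      (x^T *m principal_submx a M *m x) 0 0 <= C * (x^T *m B *m x) 0 0.
Proof.
move=> pA.
have exC (a : {set 'I_m}) : exists2 C : R, 0 <= C &
    forall B : 'M[R]_#|a|,
      principal_submx a A = map_mx Some B -> forall x : 'cV[R]_#|a|,
      (x^T *m principal_submx a M *m x) 0 0 <= C * (x^T *m B *m x) 0 0.
  (* [B0] is the only possible [B], so the constant can be chosen before [B]. If filling the gaps
     with 0 changes the block, it is not fully specified and the bound is vacuous. *)
  pose B0 := map_mx (odflt 0) (principal_submx a A).
  have B0P (B : 'M[R]_#|a|) : principal_submx a A = map_mx Some B -> B = B0.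
    by move=> AB; apply/matrixP => i j; rewrite /B0 AB !mxE.
  have [AB0|nAB0] := eqVneq (principal_submx a A) (map_mx Some B0).
    have [C C0 PC] := posdef_dominates (principal_submx a M) (pA a B0 AB0).
    by exists C => // B /B0P ->.
  by exists 0 => // B AB; case/eqP: nAB0; rewrite -(B0P _ AB).
have [C C0 PC] := fin_all_exists2 exC.
(* The sum of these nonnegative constants is at least each of them, so it serves all blocks at
   once. *)
exists (\sum_a C a); first exact: sumr_ge0.
move=> a B AB x; apply: le_trans (PC a B AB x) _.
apply: ler_wpM2r; first exact: (posdef_possemidef (pA a B AB)).2.
by rewrite (bigD1 a) //= lerDl sumr_ge0.
Qed.

Lemma partial_posdef_perturb (R : realType) (n : nat)
    (s : 'I_(2 * n).+1 -> option R) (m : 'I_(2 * n).+1 -> R) :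
  partial_posdef (hankel s) ->
  exists2 e : R, 0 < e &
    partial_possemidef (hankel (fun k => omap (fun v => v - e * m k) (s k))).
Proof.
move=> ps; have [C C0 PC] := partial_posdef_dominates (hankel m) ps.
have C1 : 0 < 1 + C by rewrite ltr_wpDr.
(* This choice gives [e * C <= 1]; the summand 1 keeps the denominator positive when [C = 0]. *)
exists (1 + C)^-1; first by rewrite invr_gt0.
set e := (1 + C)^-1 => a B'.
have e0 : 0 <= e by rewrite invr_ge0 ltW.
pose M := principal_submx a (hankel m).
have sM : M^T = M by rewrite /M /principal_submx trmx_mxsub hankel_sym.
(* The perturbation keeps the pattern, so a fully specified block [B'] comes from the block
   [B' + e M] of [s], to which the hypothesis applies. *)
move=> AB'; pose B := B' + e *: M.
have AB : principal_submx a (hankel s) = map_mx Some B.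
  apply/matrixP => i j; move/matrixP/(_ i j): AB'; rewrite !mxE.
  by case: (s _) => //= v [<-]; rewrite subrK.
have pB := ps a B AB.
have -> : B' = B - e *: M by rewrite addrK.
split=> [|x]; first by rewrite linearB /= linearZ /= pB.1 sM.
rewrite mulmxBr mulmxBl -scalemxAr -scalemxAl mxE [(- _ : 'M__) _ _]mxE
    [(_ *: _ : 'M__) _ _]mxE subr_ge0.
apply: le_trans (ler_wpM2l e0 (PC a B AB x)) _.
rewrite mulrA ler_piMl ?(posdef_possemidef pB).2 //.
by rewrite mulrC ler_pdivrMr // mul1r lerDr.
Qed.

Theorem theorem5p3 (R : realType) (n : nat) (P : {set 'I_(2 * n).+1}) :
  possemidef_completable R P -> posdef_completable R P.
Proof.
move=> cP s sP ps; pose m := @node_moments R n.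
have [e e0 ps'] := partial_posdef_perturb m ps.
have [|t' [ct' [_ pt']]] := cP _ _ ps'.
  by rewrite -sP; apply/setP => k; rewrite !inE; case: (s k).
exists (fun k => t' k + e * m k); split=> [k v skv|].
  by rewrite (ct' k (v - e * m k)) ?subrK // skv.
split=> [|x x0]; first exact: hankel_sym.
have -> : hankel (fun k => t' k + e * m k) = hankel t' + e *: hankel m.
  by apply/matrixP => i j; rewrite !mxE.
rewrite mulmxDr mulmxDl -scalemxAr -scalemxAl mxE [(_ *: _ : 'M__) _ _]mxE
  ltr_wpDl //.
by rewrite mulr_gt0 // (hankel_node_moments_posdef R n).2.
Qed.
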